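(* Let $\eta \in (0,2\pi)$ and $\Delta x > 0$, and let $\mathcal{L}$ be the linearized BGK operator $$\mathcal{L}[f](v)=\mathcal{M}[f](v)-f(v),\qquad \mathcal{M}[f](v)=\left[\int_{\mathbb{R}}\boldsymbol{\Phi}(v')f(v')\,\mathrm{d}v'\right]\begin{pmatrix}1\\ v\\ (v^2-1)/2\end{pmatrix}\omega(v).$$ Assume that $\lambda_0,\lambda_1,\lambda_2\in\mathbb{C}$ and the functions $\boldsymbol{w}_0(v),\boldsymbol{w}_1(v),\boldsymbol{w}_2(v)$ with values in $\mathbb{C}^2$ satisfy, for any $v\in\mathbb{R}$, the three equations $$\lambda_0\begin{pmatrix}\mathcal{L}&0\\0&\mathcal{L}\end{pmatrix}\boldsymbol{w}_0(v)=\boldsymbol{0},$$ $$\begin{pmatrix}\lambda_0(|v|-e^{-\mathrm{i}\eta}v^+) & e^{\mathrm{i}\eta}v^-\\ -\lambda_0 e^{-\mathrm{i}\eta}v^+ & \lambda_0(|v|+e^{\mathrm{i}\eta}v^-)\end{pmatrix}\boldsymbol{w}_0(v)=\Delta x\begin{pmatrix}\mathcal{L}&0\\0&\mathcal{L}\end{pmatrix}\big[\lambda_0\boldsymbol{w}_1(v)+\lambda_1\boldsymbol{w}_0(v)\big],$$ $$\begin{pmatrix}\lambda_0(|v|-e^{-\mathrm{i}\eta}v^+) & e^{\mathrm{i}\eta}v^-\\ -\lambda_0 e^{-\mathrm{i}\eta}v^+ & \lambda_0(|v|+e^{\mathrm{i}\eta}v^-)\end{pmatrix}\boldsymbol{w}_1(v)+\begin{pmatrix}\lambda_1(|v|-e^{-\mathrm{i}\eta}v^+)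 & 0\\ -\lambda_1 e^{-\mathrm{i}\eta}v^+ & \lambda_1(|v|+e^{\mathrm{i}\eta}v^-)\end{pmatrix}\boldsymbol{w}_0(v)=\Delta x\begin{pmatrix}\mathcal{L}&0\\0&\mathcal{L}\end{pmatrix}\big[\lambda_0\boldsymbol{w}_2(v)+\lambda_1\boldsymbol{w}_1(v)+\lambda_2\boldsymbol{w}_0(v)\big],$$ and that $\boldsymbol{w}_0$ is a nonzero function. If $\lambda_0=1/(5-4\cos(\eta))$, then $$\lambda_1=-\frac{36\sqrt{2\pi}\,[1-\cos(\eta)]}{5\,\Delta x\,[5-4\cos(\eta)]^2}<0.$$
   Context: Notation: $v\in\mathbb{R}$ is the (one-dimensional) velocity variable, $v^+=\max\{v,0\}$, $v^-=\min\{v,0\}$, $\mathrm{i}$ is the imaginary unit, and $$\boldsymbol{\Phi}(v)=(1,\,v,\,v^2-1)\ \text{(a row vector)},\qquad \omega(v)=\frac{1}{\sqrt{2\pi}}\exp\left(-\frac{v^2}{2}\right).$$ Function space: the components of $\boldsymbol{w}_0,\boldsymbol{w}_1,\boldsymbol{w}_2$ are complex-valued functions $f$ of $v$ with $\int_{\mathbb{R}}|f(v)|^2\,\omega(v)^{-1}\,\mathrm{d}v<\infty$; equalities and ''nonzero'' are understood up to null sets. The matrix $\begin{pmatrix}\mathcal{L}&0\\0&\mathcal{L}\end{pmatrix}$ applies $\mathcal{L}$ to each component. (Origin of the equations: they are the orders $\epsilon^{-1}$, $1$, $\epsilon$ of the expansion $\lambda=\lambda_0+\epsilon\lambda_1+\epsilon^2\lambda_2+\cdots$,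 $\boldsymbol{w}=\boldsymbol{w}_0+\epsilon\boldsymbol{w}_1+\epsilon^2\boldsymbol{w}_2+\cdots$ of the Fourier-mode amplification factor and amplitude of the symmetric Gauss-Seidel iteration for the first-order upwind discretization, with cell size $\Delta x$, of $v\,\partial_x f=\frac1\epsilon\mathcal{L}[f]$.) *)

(* Defs.v *)
From HB Require Import structures.
From mathcomp Require Import all_boot all_order all_algebra.
From mathcomp Require Import all_classical all_reals all_analysis.
From mathcomp Require Export complex.
Set Implicit Arguments.
Unset Strict Implicit.
Unset Printing Implicit Defensive.

Import Order.TTheory GRing.Theory Num.Theory.
Import numFieldNormedType.Exports.
Local Open Scope classical_set_scope.
Local Open Scope ring_scope.
Local Open Scope complex_scope.

Section Definitions.
Context {R : realType}.
Notation mu := (@lebesgue_measure R).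

Definition posp (v : R) : R := Num.max v 0.
(* min{v, 0}: the nonpositive part, so v = v^+ + v^- and |v| = v^+ - v^-. *)
Definition negp (v : R) : R := Num.min v 0.

(* exp(i t) *)
Definition cis (t : R) : R[i] := cos t +i* sin t.

Definition omega (v : R) : R :=
  1 / Num.sqrt (2 * pi) * expR (- (v ^+ 2 / 2)).

Definition Phi (v : R) : 'rV[R[i]]_3 :=
  \row_(j < 3) (nth 0 [:: 1; v; v ^+ 2 - 1] j)%:C.

Definition Psi (v : R) : 'cV[R[i]]_3 :=
  \col_(j < 3) (nth 0 [:: 1; v; (v ^+ 2 - 1) / 2] j)%:C.

(* Lebesgue integral over R of a complex-valued function. *)
Definition Cintegral (f : R -> R[i]) : R[i] :=
  Rintegral mu setT (fun v => complex.Re (f v))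
  +i* Rintegral mu setT (fun v => complex.Im (f v)).

Definition moments (f : R -> R[i]) : 'rV[R[i]]_3 :=
  \row_(j < 3) Cintegral (fun v => Phi v ord0 j * f v).

Definition Mop (f : R -> R[i]) (v : R) : R[i] :=
  (moments f *m Psi v) ord0 ord0 * (omega v)%:C.

Definition BGK (f : R -> R[i]) (v : R) : R[i] := Mop f v - f v.

(* The block-diagonal operator diag(L, L). *)
Definition BGK2 (w : R -> 'cV[R[i]]_2) (v : R) : 'cV[R[i]]_2 :=
  \col_(k < 2) BGK (fun u => w u k ord0) v.

(* Measurability is with respect to the Borel sigma-algebra; every
   Lebesgue-measurable function agrees with such a function up to a null
   set. *)
Definition weighted_L2 (f : R -> R[i]) : Prop :=
  [/\ measurable_fun setT (fun v => complex.Re (f v)),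
      measurable_fun setT (fun v => complex.Im (f v)) &
      (\int[mu]_v (Normc.normc (f v) ^+ 2 * (omega v)^-1)%:E < +oo)%E].

Definition weighted_L2_2 (w : R -> 'cV[R[i]]_2) : Prop :=
  forall k : 'I_2, weighted_L2 (fun v => w v k ord0).

Definition mx22 (a b c d : R[i]) : 'M[R[i]]_2 :=
  \matrix_(j < 2, k < 2) nth 0 (nth [::] [:: [:: a; b]; [:: c; d]] j) k.

Definition transport0_mx (eta : R) (lambda : R[i]) (v : R) : 'M[R[i]]_2 :=
  mx22 (lambda * (`|v|%:C - cis (- eta) * (posp v)%:C))
       (cis eta * (negp v)%:C)
       (- lambda * cis (- eta) * (posp v)%:C)
       (lambda * (`|v|%:C + cis eta * (negp v)%:C)).

(* The lambda-dependent part of transport0_mx: the entry e^{i eta} v^-, which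
   carries no factor lambda, drops out. *)
Definition transport1_mx (eta : R) (lambda : R[i]) (v : R) : 'M[R[i]]_2 :=
  mx22 (lambda * (`|v|%:C - cis (- eta) * (posp v)%:C))
       0
       (- lambda * cis (- eta) * (posp v)%:C)
       (lambda * (`|v|%:C + cis eta * (negp v)%:C)).

End Definitions.

(* Main.v *)
Require Import Defs.
From HB Require Import structures.
From mathcomp Require Import all_boot all_order all_algebra.
From mathcomp Require Import all_classical all_reals all_analysis.
From mathcomp Require Import complex.
From mathcomp Require Import measurable_realfun ring lra.
Import Order.TTheory GRing.Theory Num.Theory.
Import numFieldNormedType.Exports.
Local Open Scope classical_set_scope.
Local Open Scope ring_scope.
Local Open Scope complex_scope.

(** Write z = v^2 - 3, e = exp(i eta) and s = 1 / sqrt (2 pi).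

At leading order the collision operator annihilates [w0], so [w0] is a
Maxwellian: the Gaussian [omega] times a vector polynomial
x0 + v x1 + v^2 x2. Collisions conserve mass, momentum and energy, so at each
later order the moments of the transport term against 1, v, v^2 vanish
([vmoment_collision]); these are finite-dimensional conditions, whose
coefficients are the half-line moments of [omega] ([half_momentE]).

At the first order they say that (x0, x1, x2) lies in the kernel of a pencil
built from the Gram matrices A and B of 1, v, v^2 for the weights v^+ omega
and - v^- omega. At the prescribed [lambda0] this kernel comes from the
generalized eigenvalue 1 of (A, B), whose eigenvector is z: its elements are
the multiples of (1, kappa) z with kappa = 1 / (e (2 - e)) ([pencil_kernel]).

The first-order equation also expresses lambda0 w1 through [w0], up to an
unknown Maxwellian. At the second order, the averaged operator acting on that
unknown is singular, with left null vector (1, 2 e - 1) z. Pairing with this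
vector removes the unknown and leaves a scalar equation, linear in [lambda1]
([averaged_corrector], [eigenvalue_correction]); in it the coefficient of
[lambda1] comes from the integral of v^+ z^2 omega, which is 5 s, and the
other term from the integral of (v^+)^2 z^2 omega, which is 3. *)

(** * Half-line moments of the Gaussian *)

Section RealMoments.
Set Implicit Arguments.
Unset Strict Implicit.
Unset Printing Implicit Defensive.
Context {R : realType}.
Local Notation mu := (@lebesgue_measure R).
Local Notation integrable g := (mu.-integrable setT (EFin \o g)).
Implicit Types (g h a : R -> R) (v : R) (n : nat).

Lemma omegaE : @omega R = normal_pdf 0 1.
Proof.
rewrite (normal_pdfE 0 (oner_neq0 R)); apply/funext => v.
rewrite /omega /normal_peak /normal_fun expr1n mul1r subr0 mulNr.
by rewrite mul1r mulr_natl.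
Qed.

Lemma omega_gt0 v : 0 < omega v.
Proof.
by rewrite /omega mulr_gt0 ?expR_gt0// divr_gt0// sqrtr_gt0 mulr_gt0// pi_gt0.
Qed.

Lemma continuous_omega : continuous (@omega R).
Proof. by rewrite omegaE; apply: continuous_normal_pdf; exact: oner_neq0. Qed.

Lemma measurable_omega : measurable_fun setT (@omega R).
Proof. by rewrite omegaE; exact: measurable_normal_pdf. Qed.

Lemma omegaN v : omega (- v) = omega v.
Proof. by rewrite /omega sqrrN. Qed.

Lemma is_derive_omega v : is_derive v 1 (@omega R) (- v * omega v).
Proof.
rewrite /omega; apply: is_derive_eq.
by rewrite /GRing.scale /=; set c := 1 / Num.sqrt _; set E := expR _; field.
Qed.

Lemma expn_le_expR n (x : R) : 0 <= x -> x ^+ n <= n`!%:R * expR x.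
Proof.
move=> x0; case: n => [|n]; first by rewrite expr0 fact0 mul1r -expR0 ler_expR.
rewrite mulrC -ler_pdivrMr ?ltr0n ?fact_gt0//.
by apply: le_trans (expR_ge1Dxn n x0); rewrite lerDr.
Qed.

(** Half of the Gaussian exponent absorbs any polynomial, by [expn_le_expR] at
    x = (1 + v^2) / 4. *)
Lemma omega_decay n : exists2 K : R, 0 <= K &
  forall v, (1 + v ^+ 2) ^+ n * omega v <= K * expR (- v ^+ 2 / 4).
Proof.
exists (1 / Num.sqrt (2 * pi) * (4 ^+ n * n`!%:R * expR (1 / 4))).
  by rewrite !mulr_ge0 ?expR_ge0 ?exprn_ge0 ?invr_ge0 ?sqrtr_ge0.
move=> v; rewrite /omega mulrCA -[leRHS]mulrA.
rewrite ler_wpM2l// ?divr_ge0 ?sqrtr_ge0//.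
set x := (1 + v ^+ 2) / 4.
have x0 : 0 <= x by rewrite divr_ge0// addr_ge0// sqr_ge0.
have -> : 1 + v ^+ 2 = 4 * x by rewrite /x; field.
have -> : - (v ^+ 2 / 2) = - x + (1 / 4 + - v ^+ 2 / 4) by rewrite /x; field.
rewrite !expRD expRN exprMn -[leLHS]mulrA -[leRHS]mulrA -mulrA.
rewrite ler_wpM2l ?exprn_ge0// [leLHS]mulrA ler_wpM2r ?mulr_ge0 ?expR_ge0//.
by rewrite ler_pdivrMr ?expR_gt0// expn_le_expR.
Qed.

Lemma integrable_wide_gaussian : integrable (fun v => expR (- v ^+ 2 / 4)).
Proof.
have s0 : Num.sqrt 2 != 0 :> R by rewrite gt_eqF// sqrtr_gt0.
have := integrableZl measurableT (normal_peak (Num.sqrt 2 : R))^-1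
  (@integrable_normal_pdf R 0 _).
move/(_ (Num.sqrt 2)); apply: eq_integrable => // v _ /=.
rewrite normal_pdfE// -EFinM mulKf ?gt_eqF ?normal_peak_gt0//.
rewrite /normal_fun subr0 sqr_sqrtr//; congr (EFin (expR (_ / _))).
by rewrite -mulrnA.
Qed.

(** Convergence of all polynomial moments. Unlike the weighted square-integrable
    functions, this class is stable under multiplication by v, v^+ and v^-, so
    that the integrals of all terms of the equations split linearly. *)
Definition real_rapid g : Prop := measurable_fun setT g /\
  forall n, integrable (fun v => (1 + v ^+ 2) ^+ n * g v).

Lemma measurable_weight n : measurable_fun setT (fun v : R => (1 + v ^+ 2) ^+
  n).
Proof.
by apply: measurable_funX; apply: measurable_funD => //; exact: measurable_funX.
Qed.

Lemma real_rapid_omega : real_rapid (@omega R).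
Proof.
split; first exact: measurable_omega.
move=> n; have [K K0 HK] := omega_decay n.
have := integrableZl measurableT K integrable_wide_gaussian.
apply: le_integrable => //.
  apply/measurable_EFinP; apply: measurable_funM; last exact: measurable_omega.
  exact: measurable_weight.
move=> v _; rewrite /= !lee_fin ger0_norm; last first.
  by rewrite mulr_ge0 ?exprn_ge0 ?addr_ge0 ?sqr_ge0// ltW// omega_gt0.
by rewrite ger0_norm ?mulr_ge0 ?expR_ge0// HK.
Qed.

Lemma real_rapidD g h : real_rapid g -> real_rapid h ->
  real_rapid (fun v => g v + h v).
Proof.
move=> [mg ig] [mh ih]; split; first exact: measurable_funD.
move=> n; apply: eq_integrable (integrableD measurableT (ig n) (ih n)) => //.
by move=> v _; rewrite /= -EFinD mulrDr.
Qed.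

Lemma real_rapidZ c g : real_rapid g -> real_rapid (fun v => c * g v).
Proof.
move=> [mg ig]; split; first exact: measurable_funM.
move=> n; apply: eq_integrable (integrableZl measurableT c (ig n)) => //.
by move=> v _; rewrite /= -EFinM mulrCA.
Qed.

Definition poly_growth a : Prop := measurable_fun setT a /\
  exists n, forall v, `|a v| <= (1 + v ^+ 2) ^+ n.

Lemma real_rapidM a g : poly_growth a -> real_rapid g ->
  real_rapid (fun v => a v * g v).
Proof.
move=> [ma [m am]] [mg ig]; split; first exact: measurable_funM.
move=> n; apply: le_integrable (ig (n + m)%N) => //.
  apply/measurable_EFinP; apply: measurable_funM; last exact: measurable_funM.
  exact: measurable_weight.
move=> v _; rewrite /= lee_fin exprD !normrM mulrA ler_wpM2r// ler_wpM2l//.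
by rewrite (le_trans (am v))// ler_norm.
Qed.

Lemma real_rapid_integrable g : real_rapid g -> integrable g.
Proof.
move=> [_ /(_ 0%N)]; apply: eq_integrable => // v _ /=.
by rewrite expr0 mul1r.
Qed.

Lemma poly_growthM a b : poly_growth a -> poly_growth b ->
  poly_growth (fun v => a v * b v).
Proof.
move=> [ma [m am]] [mb [n bn]]; split; first exact: measurable_funM.
by exists (m + n)%N => v; rewrite normrM exprD ler_pM.
Qed.

Lemma poly_growth_exp a n : poly_growth a -> poly_growth (fun v => a v ^+ n).
Proof.
move=> ta; elim: n => [|n ih].
  by split => //; exists 0%N => v; rewrite !expr0 normr1.
have := poly_growthM ta ih; under eq_fun do rewrite -exprS; exact.
Qed.

Lemma poly_growth_le a : measurable_fun setT a ->
  (forall v, `|a v| <= `|v|) -> poly_growth a.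
Proof.
move=> ma av; split => //; exists 1%N => v; rewrite expr1.
apply: (le_trans (av v)); rewrite -[v ^+ 2]real_normK ?num_real//.
by have := normr_ge0 v; nra.
Qed.

Lemma measurable_posp : measurable_fun setT (@posp R).
Proof. exact: measurable_maxr. Qed.

Lemma measurable_negp : measurable_fun setT (@negp R).
Proof. exact: measurable_minr. Qed.

(** Both half-line parts are taken nonnegative: v = posp v - leftp v and
    |v| = posp v + leftp v. *)
Definition leftp v : R := - negp v.

Lemma poly_growth_id : poly_growth (fun v => v).
Proof. exact: poly_growth_le. Qed.

Lemma poly_growth_pow n : poly_growth (fun v => v ^+ n).
Proof. exact/poly_growth_exp/poly_growth_id. Qed.

Lemma poly_growth_posp : poly_growth (@posp R).
Proof.
apply: poly_growth_le => [|v]; first exact: measurable_posp.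
by rewrite /posp; case: (leP v 0) => // _; rewrite normr0.
Qed.

Lemma poly_growth_leftp : poly_growth leftp.
Proof.
apply: poly_growth_le => [|v]; first by apply: measurable_funN;
  exact: measurable_negp.
by rewrite /leftp normrN /negp; case: (leP v 0) => // _; rewrite normr0.
Qed.

Lemma cvg_omegaX n : v ^+ n * omega v @[v --> +oo] --> (0 : R).
Proof.
have [K K0 HK] := omega_decay n.
have cvgK : K * expR (- v ^+ 2 / 4) @[v --> +oo] --> (0 : R).
  rewrite -(mulr0 K); apply: cvgMr.
  have : expR (- v) @[v --> +oo] --> (0 : R) by exact: cvgr_expR.
  apply: squeeze_cvgr (cvg_cst 0); near=> v.
  rewrite expR_ge0 ler_expR.
  have v4 : 4 <= v by near: v; exact: nbhs_pinfty_ge.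
  by nra.
apply: squeeze_cvgr (cvg_cst 0) cvgK; near=> v.
have v0 : 0 <= v by near: v; exact: nbhs_pinfty_ge.
rewrite mulr_ge0 ?exprn_ge0 ?(ltW (omega_gt0 v))//=.
apply: le_trans (HK v); rewrite ler_wpM2r ?(ltW (omega_gt0 v))//.
by rewrite lerXn2r ?nnegrE// ?addr_ge0 ?sqr_ge0//; nra.
Unshelve. all: by end_near. Qed.

Definition half_moment n : R := \int[mu]_(v in `[0, +oo[) (v ^+ n * omega v).

Lemma integrable_omegaX n : integrable (fun v => v ^+ n * omega v).
Proof.
by apply/real_rapid_integrable/real_rapidM;
  [exact: poly_growth_pow|exact: real_rapid_omega].
Qed.

Lemma is_derive_omegaX n v : is_derive v 1 (fun v => - (v ^+ n * omega v))
  (v ^+ n.+1 * omega v - n%:R * (v ^+ n.-1 * omega v)).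
Proof.
have dX := @is_deriveX _ _ (@id R) n v 1 1 (is_derive_id v 1).
have := is_deriveN (is_deriveM dX (is_derive_omega v)).
rewrite (_ : - (id ^+ n * _) = fun v : R => - (v ^+ n * omega v)); last first.
  by apply/funext => x; rewrite !fctE.
by move=> /is_derive_eq; apply; rewrite !fctE /GRing.scale /= exprS; ring.
Qed.

(** Integration by parts: the integrand f below is the derivative of
    - v^n omega. The fundamental theorem on an unbounded interval is applied
    where f has a sign, namely to the right of sqrt n, and the compact one to
    the left. When n = 0 the truncated predecessor has coefficient 0. *)
Lemma half_moment_rec n :
  half_moment n.+1 = n%:R * half_moment n.-1 + (n == 0%N)%:R * omega 0.
Proof.
pose F v : R := - (v ^+ n * omega v).
pose f v : R := v ^+ n.+1 * omega v - n%:R * (v ^+ n.-1 * omega v).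
have dF v : is_derive v 1 F (f v) by exact: is_derive_omegaX.
have derF v : derivable F v 1 by have [] := dF v.
have dFf : derive1 F =1 f by move=> v; rewrite derive1E; have [_ ->] := dF v.
have cX m : continuous (fun v : R => v ^+ m * omega v).
  by move=> v; apply: cvgM; [exact: exprn_continuous|exact: continuous_omega].
have cf : continuous f.
  by move=> v; apply: cvgB; [exact: cX|apply: cvgMr; exact: cX].
have cF : continuous F by move=> v; apply: cvgN; exact: cX.
have Fy : F v @[v --> +oo] --> (0 : R).
  by rewrite -oppr0; apply: cvgN; exact: cvg_omegaX.
have fi : mu.-integrable setT (EFin \o f).
  have := integrableB measurableT (integrable_omegaX n.+1)
    (integrableZl measurableT n%:R (integrable_omegaX n.-1)).
  by apply: eq_integrable => // v _ /=; rewrite -EFinM -EFinB.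
have fiS (D : set R) : measurable D -> mu.-integrable D (EFin \o f).
  by move=> mD; apply: integrableS fi.
have fE : \int[mu]_(v in `[0, +oo[) f v =
  half_moment n.+1 - n%:R * half_moment n.-1.
  rewrite RintegralB//; last 2 first.
    by apply: integrableS (integrable_omegaX _).
    have := integrableZl measurableT n%:R (integrable_omegaX n.-1).
    by apply: integrableS.
  rewrite RintegralZl//.
  by apply: integrableS (integrable_omegaX _).
suff : \int[mu]_(v in `[0, +oo[) f v = 0 - F 0.
  by rewrite fE /F opprK add0r expr0n => /eqP; rewrite subr_eq addrC => /eqP.
pose c : R := Num.sqrt n%:R.
have c0 : 0 <= c by exact: sqrtr_ge0.
have c2 : c ^+ 2 = n%:R by rewrite sqr_sqrtr.
have tail : \int[mu]_(v in `[c, +oo[) f v = 0 - F c.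
  apply: Rintegral_ge0_continuous_FTC2y => //.
  - move=> v cv; rewrite /f mulrA -mulrBl mulr_ge0 ?(ltW (omega_gt0 v))//.
    have v0 : 0 <= v by exact: le_trans cv.
    case: (n) c2 => [|m] c2; first by rewrite mul0r subr0 expr1.
    rewrite -c2 !exprS/= mulrA -mulrBl mulr_ge0 ?exprn_ge0// subr_ge0.
    by rewrite expr0 mulr1 ler_pM.
  - exact: continuous_subspaceT.
  - by apply: cvg_at_right_filter; exact: cF.
have [c_eq0|cN0] := eqVneq c 0; first by rewrite -c_eq0 tail c_eq0.
have c_gt0 : 0 < c by rewrite lt_def cN0.
have head : \int[mu]_(v in `[0, c]) f v = F c - F 0.
  rewrite /Rintegral (@continuous_FTC2 _ f F)//.
  - exact: continuous_subspaceT.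
  - by split => //; [apply: cvg_at_right_filter|apply: cvg_at_left_filter];
    exact: cF.
have := @Rintegral_itvB _ f (BLeft 0) (BInfty R false) c (fiS _ _).
rewrite !bnd_simp head Rintegral_itv_obnd_cbnd ?tail; last exact: fiS.
by move=> /(_ (measurable_itv _) c0 isT); lra.
Qed.

Lemma even_omega_integral (h : R -> R) : (forall v, 0 <= h v) ->
  continuous h -> (forall v, h (- v) = h v) ->
  \int[mu]_v (h v * omega v) = 2 * \int[mu]_(v in `[0, +oo[) (h v * omega v).
Proof.
move=> h0 ch hN; rewrite /Rintegral ge0_symfun_integralT; last 3 first.
- by move=> v; rewrite mulr_ge0// ltW// omega_gt0.
- by move=> v; apply: cvgM; [exact: ch|exact: continuous_omega].
- by move=> v /=; rewrite hN omegaN.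
rewrite -set_itvcy; case: (integral _ _ _) => [r||] //=.
  by rewrite gt0_muley ?lte_fin// mulr0.
by rewrite gt0_muleNy ?lte_fin// mulr0.
Qed.

Lemma omega_integral : \int[mu]_v omega v = 1.
Proof.
by rewrite omegaE /Rintegral integral_normal_pdf.
Qed.

Lemma half_moment0 : half_moment 0 = 1 / 2.
Proof.
have := @even_omega_integral (fun _ => 1) (fun _ => ler01) _ (fun _ => erefl).
under eq_Rintegral do rewrite mul1r.
rewrite omega_integral /half_moment => /(_ (fun _ => cvg_cst _)).
under [X in 2 * X]eq_Rintegral do rewrite mul1r.
under [X in _ -> X = _]eq_Rintegral do rewrite expr0 mul1r.
by move=> h; lra.
Qed.

Lemma omega_at0 : omega 0 = (Num.sqrt (2 * pi))^-1 :> R.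
Proof. by rewrite /omega expr0n mul0r oppr0 expR0 mulr1 div1r. Qed.

Lemma half_momentE :
  [/\ half_moment 1 = omega 0, half_moment 2 = 1 / 2,
      half_moment 3 = 2 * omega 0, half_moment 4 = 3 / 2 &
      half_moment 5 = 8 * omega 0 /\ half_moment 6 = 15 / 2].
Proof.
by rewrite !half_moment_rec /= half_moment0; split; try split; field.
Qed.

Lemma pospX_integral n :
  \int[mu]_v (posp v ^+ n.+1 * omega v) = half_moment n.+1.
Proof.
rewrite /half_moment [RHS]Rintegral_mkcond; apply: eq_Rintegral => v _.
rewrite patchE /posp; case: ifPn => [|];
  rewrite ?notin_setE ?inE/= in_itv/= andbT.
  by move=> v0; rewrite max_l.
by move=> /negP; rewrite -ltNge => v0; rewrite max_r ?ltW// expr0n mul0r.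
Qed.

Lemma integrable_growthM a : poly_growth a ->
  integrable (fun v => a v * omega v).
Proof. by move=> ta; apply/real_rapid_integrable/real_rapidM/real_rapid_omega.
  Qed.

(** The even function |v|^(n+1) has twice the half-line moment, and its right
    half accounts for one of them. *)
Lemma leftpX_integral n :
  \int[mu]_v (leftp v ^+ n.+1 * omega v) = half_moment n.+1.
Proof.
have H : \int[mu]_v (`|v| ^+ n.+1 * omega v) = 2 * half_moment n.+1.
  rewrite (even_omega_integral (h := fun v => `|v| ^+ n.+1)).
  - congr (_ * _); apply: eq_Rintegral => v; rewrite inE/= in_itv/= andbT => v0.
    by rewrite ger0_norm.
  - by move=> v; rewrite exprn_ge0.
  - move=> v; apply: (@continuous_comp _ _ _ _ (fun v : R => v ^+ n.+1)).
      exact: norm_continuous.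
    exact: exprn_continuous.
  - by move=> v; rewrite normrN.
have : \int[mu]_v (`|v| ^+ n.+1 * omega v) =
    \int[mu]_v (posp v ^+ n.+1 * omega v) + \int[mu]_v (leftp v ^+ n.+1 *
      omega v).
  rewrite -RintegralD//; last 2 first.
  - exact/integrable_growthM/poly_growth_exp/poly_growth_posp.
  - exact/integrable_growthM/poly_growth_exp/poly_growth_leftp.
  apply: eq_Rintegral => v _; rewrite -mulrDl /posp /leftp /negp; congr (_ * _).
  case: (leP v 0) => v0; first by rewrite ler0_norm// expr0n add0r.
  by rewrite gtr0_norm// oppr0 expr0n addr0.
by rewrite H pospX_integral; lra.
Qed.

Lemma velocityE v : v = posp v - leftp v.
Proof. by rewrite /posp /leftp /negp; case: (leP v 0) => _;
  rewrite opprK ?add0r ?addr0. Qed.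

Lemma normr_posp v : `|v| = posp v + leftp v.
Proof.
rewrite /posp /leftp /negp; case: (leP v 0) => v0.
  by rewrite ler0_norm// add0r.
by rewrite gtr0_norm// oppr0 addr0.
Qed.

Lemma posp_leftp v : posp v * leftp v = 0.
Proof.
by rewrite /posp /leftp /negp; case: (leP v 0) => _;
  rewrite ?mul0r// oppr0 mulr0.
Qed.

Lemma powers_posp n v : v ^+ n * posp v = posp v ^+ n.+1.
Proof.
rewrite /posp exprSr; case: (leP v 0) => // _; by rewrite !mulr0.
Qed.

Lemma powers_leftp n v : v ^+ n * leftp v = (-1) ^+ n * leftp v ^+ n.+1.
Proof.
rewrite /leftp /negp exprSr; case: (leP v 0) => _.
  by rewrite mulrA -exprMn mulN1r opprK.
by rewrite oppr0 !mulr0.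
Qed.

Lemma powers_integral n : \int[mu]_v (v ^+ n.+1 * omega v) =
  (1 + (-1) ^+ n.+1) * half_moment n.+1.
Proof.
rewrite mulrDl mul1r -[X in X + _]pospX_integral -leftpX_integral.
rewrite -RintegralZl//;
  last exact/integrable_growthM/poly_growth_exp/poly_growth_leftp.
rewrite -RintegralD//; last 2 first.
- exact/integrable_growthM/poly_growth_exp/poly_growth_posp.
- have := integrable_growthM (poly_growth_exp n.+1 poly_growth_leftp).
  move/(integrableZl measurableT ((-1) ^+ n.+1)).
  by apply: eq_integrable => // v _ /=; rewrite -EFinM.
apply: eq_Rintegral => v _; rewrite mulrA -mulrDl; congr (_ * _).
rewrite exprSr {2}(velocityE v) mulrBr powers_posp powers_leftp.
rewrite [(-1) ^+ n.+1]exprS mulN1r.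
by rewrite mulNr.
Qed.

End RealMoments.

(** * Moments of complex and vector-valued functions *)

Section ComplexMoments.
Set Implicit Arguments.
Unset Strict Implicit.
Unset Printing Implicit Defensive.
Context {R : realType}.
Local Notation mu := (@lebesgue_measure R).
Local Notation integrable g := (mu.-integrable setT (EFin \o g)).
Implicit Types (a b : R -> R) (f g : R -> R[i]) (c : R[i]) (v : R).
Implicit Types (w : R -> 'cV[R[i]]_2).

Lemma ReM (x y : R[i]) :
  complex.Re (x * y) = complex.Re x * complex.Re y - complex.Im x * complex.Im
    y.
Proof. by case: x y => [x1 x2] [y1 y2]. Qed.

Lemma ImM (x y : R[i]) :
  complex.Im (x * y) = complex.Re x * complex.Im y + complex.Im x * complex.Re
    y.
Proof. by case: x y => [x1 x2] [y1 y2]. Qed.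

Lemma ReD (x y : R[i]) : complex.Re (x + y) = complex.Re x + complex.Re y.
Proof. by case: x y => [x1 x2] [y1 y2]. Qed.

Lemma ImD (x y : R[i]) : complex.Im (x + y) = complex.Im x + complex.Im y.
Proof. by case: x y => [x1 x2] [y1 y2]. Qed.

Definition complex_rapid f : Prop :=
  real_rapid (fun v => complex.Re (f v)) /\ real_rapid (fun v => complex.Im (f
    v)).

Lemma complex_rapidD f g : complex_rapid f -> complex_rapid g ->
  complex_rapid (fun v => f v + g v).
Proof.
move=> [fr fi] [gr gi]; split.
  by under eq_fun do rewrite ReD; exact: real_rapidD.
by under eq_fun do rewrite ImD; exact: real_rapidD.
Qed.

Lemma complex_rapidZ c f : complex_rapid f -> complex_rapid (fun v => c * f v).
Proof.
move=> [fr fi]; split.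
  under eq_fun do rewrite ReM -mulNr.
  by apply: real_rapidD; exact: real_rapidZ.
under eq_fun do rewrite ImM.
by apply: real_rapidD; exact: real_rapidZ.
Qed.

Lemma complex_rapid_scale a f : poly_growth a -> complex_rapid f ->
  complex_rapid (fun v => (a v)%:C * f v).
Proof.
move=> ta [fr fi]; split.
  under eq_fun do rewrite ReM /= mul0r subr0.
  exact: real_rapidM.
under eq_fun do rewrite ImM /= mul0r addr0.
exact: real_rapidM.
Qed.

Lemma complex_rapid_real (g : R -> R) : real_rapid g ->
  complex_rapid (fun v => (g v)%:C).
Proof.
move=> fg; split => //=.
by have := real_rapidZ 0 fg; under eq_fun do rewrite mul0r.
Qed.

Lemma CintegralD f g : complex_rapid f -> complex_rapid g ->
  Cintegral (fun v => f v + g v) = Cintegral f + Cintegral g.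
Proof.
move=> [fr fi] [gr gi]; rewrite /Cintegral.
under eq_Rintegral do rewrite ReD.
under [X in _ +i* X]eq_Rintegral do rewrite ImD.
by rewrite !RintegralD//; exact: real_rapid_integrable.
Qed.

Lemma CintegralZ c f : complex_rapid f ->
  Cintegral (fun v => c * f v) = c * Cintegral f.
Proof.
move=> [fr fi]; rewrite /Cintegral.
under eq_Rintegral do rewrite ReM.
under [X in _ +i* X]eq_Rintegral do rewrite ImM.
rewrite RintegralB//; [|exact/real_rapid_integrable/real_rapidZ..].
rewrite RintegralD//; [|exact/real_rapid_integrable/real_rapidZ..].
rewrite !RintegralZl//; [|exact/real_rapid_integrable..].
by case: c.
Qed.

Lemma ae_imp (P Q : R -> Prop) : (forall v, P v -> Q v) ->
  {ae mu, forall v, P v} -> {ae mu, forall v, Q v}.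
Proof.
by move=> PQ; apply: (@filterS _ (almost_everywhere mu)).
Qed.

Lemma Cintegral_ae f g : complex_rapid f -> complex_rapid g ->
  {ae mu, forall v, f v = g v} -> Cintegral f = Cintegral g.
Proof.
move=> [fr fi] [gr gi] fg; rewrite /Cintegral /Rintegral.
congr (fine _ +i* fine _); apply: ae_eq_integral => //.
- by apply/measurable_EFinP; case: fr.
- by apply/measurable_EFinP; case: gr.
- by apply: ae_imp fg => v ->.
- by apply/measurable_EFinP; case: fi.
- by apply/measurable_EFinP; case: gi.
- by apply: ae_imp fg => v ->.
Qed.

Lemma Cintegral_real (g : R -> R) :
  Cintegral (fun v => (g v)%:C) = (\int[mu]_v g v)%:C.
Proof.
rewrite /Cintegral /=; congr (_ +i* _).
by rewrite Rintegral_cst// mul0r.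
Qed.

(** For the weight W = (1 + v^2)^n, W |x| <= x^2 / omega + W^2 omega. *)
Lemma real_rapid_L2 (x : R -> R) : measurable_fun setT x ->
  integrable (fun v => x v ^+ 2 / omega v) -> real_rapid x.
Proof.
move=> mx ix; split=> // n.
have /real_rapid_integrable iw :
    real_rapid (fun v => (1 + v ^+ 2) ^+ (2 * n) * omega v).
  apply/real_rapidM/real_rapid_omega; split; first exact: measurable_weight.
  exists (2 * n)%N => v; rewrite ger0_norm//.
  by rewrite exprn_ge0// addr_ge0// sqr_ge0.
apply: le_integrable (integrableD measurableT ix iw) => //.
  apply/measurable_EFinP; apply: measurable_funM mx.
  exact: measurable_weight.
move=> v _; rewrite /= lee_fin; apply: le_trans (ler_norm _).
have o0 := omega_gt0 v; have W0 : 0 <= (1 + v ^+ 2) ^+ n.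
  by rewrite exprn_ge0// addr_ge0// sqr_ge0.
rewrite normrM (ger0_norm W0) mulnC exprM -(ler_pM2r o0) mulrDl mulfVK
  ?gt_eqF//.
rewrite -[x v ^+ 2]real_normK ?num_real//.
move: W0; set W := (1 + _) ^+ n; set y := `|x v|; move: (omega v) o0 => o o0 W0.
have : 0 <= W * o by rewrite mulr_ge0// ltW.
have : 0 <= y by exact: normr_ge0.
by set z := W * o => y0 z0; have -> : W * y * o = y * z; [rewrite /z; ring|];
  have -> : W ^+ 2 * o * o = z ^+ 2; [rewrite /z; ring|]; nra.
Qed.

Lemma complex_rapid_L2 f : weighted_L2 f -> complex_rapid f.
Proof.
move=> [mr mi fin].
have mo : measurable_fun setT (fun v : R => (omega v)^-1).
  have : measurable_fun setT
      (fun v : R => Num.sqrt (2 * pi) * expR (v ^+ 2 / 2)).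
    apply: measurable_funM => //; apply: measurableT_comp => //.
    by apply: measurable_funM => //; exact: measurable_funX.
  apply: eq_measurable_fun => v _.
  by rewrite /omega invfM expRN !invrK div1r invrK.
have key (x : R -> R) : measurable_fun setT x ->
    (forall v, x v ^+ 2 <= Normc.normc (f v) ^+ 2) -> real_rapid x.
  move=> mx xf; apply: real_rapid_L2 => //.
  apply/integrableP; split.
    by apply/measurable_EFinP; apply: measurable_funM mo;
      exact: measurable_funX.
  apply: le_lt_trans fin; apply: ge0_le_integral => //.
  - by apply/measurable_EFinP; apply: measurableT_comp => //;
      apply: measurable_funM mo; exact: measurable_funX.
  - apply/measurable_EFinP; apply: measurable_funM mo.
    under eq_fun => v.
      have -> : Normc.normc (f v) ^+ 2 =
          complex.Re (f v) ^+ 2 + complex.Im (f v) ^+ 2.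
        by case: (f v) => p q; rewrite /= sqr_sqrtr// addr_ge0// sqr_ge0.
      over.
    by apply: measurable_funD; exact: measurable_funX.
  - move=> v _; rewrite /= lee_fin ger0_norm; last first.
      by rewrite mulr_ge0 ?sqr_ge0// invr_ge0 ltW// omega_gt0.
    by rewrite ler_wpM2r// invr_ge0 ltW// omega_gt0.
split; apply: key => // v; case: (f v) => p q /=;
  by rewrite sqr_sqrtr ?addr_ge0 ?sqr_ge0// ?lerDl ?lerDr sqr_ge0.
Qed.

Definition vector_rapid w : Prop :=
  forall k, complex_rapid (fun v => w v k ord0).

Definition vmoment a w : 'cV[R[i]]_2 :=
  \col_k Cintegral (fun v => (a v)%:C * w v k ord0).

Lemma vector_rapidD w w' : vector_rapid w -> vector_rapid w' ->
  vector_rapid (fun v => w v + w' v).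
Proof.
by move=> fw fw' k; under eq_fun do rewrite mxE; exact: complex_rapidD.
Qed.

Lemma vector_rapidM (M : 'M[R[i]]_2) w : vector_rapid w ->
  vector_rapid (fun v => M *m w v).
Proof.
move=> fw k; under eq_fun do rewrite mxE 2!big_ord_recl big_ord0 addr0.
by apply: complex_rapidD; exact: complex_rapidZ.
Qed.

Lemma vector_rapidZ c w : vector_rapid w -> vector_rapid (fun v => c *: w v).
Proof. by move=> fw k; under eq_fun do rewrite mxE; exact: complex_rapidZ. Qed.

Lemma vector_rapid_scale a w : poly_growth a -> vector_rapid w ->
  vector_rapid (fun v => (a v)%:C *: w v).
Proof. by move=> ta fw k; under eq_fun do rewrite mxE;
  exact: complex_rapid_scale. Qed.

Lemma vector_rapid_L2 w : weighted_L2_2 w -> vector_rapid w.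
Proof. by move=> H k; exact: complex_rapid_L2. Qed.

Lemma vmomentD a w w' : poly_growth a -> vector_rapid w -> vector_rapid w' ->
  vmoment a (fun v => w v + w' v) = vmoment a w + vmoment a w'.
Proof.
move=> ta fw fw'; apply/matrixP => k j; rewrite !mxE -CintegralD.
- by congr Cintegral; apply/funext => v; rewrite mxE mulrDr.
- exact: complex_rapid_scale.
- exact: complex_rapid_scale.
Qed.

Lemma vmomentM a (M : 'M[R[i]]_2) w : poly_growth a -> vector_rapid w ->
  vmoment a (fun v => M *m w v) = M *m vmoment a w.
Proof.
move=> ta fw; apply/matrixP => k j;
  rewrite !mxE 2!big_ord_recl big_ord0 addr0 !mxE.
rewrite -!CintegralZ; [|exact: complex_rapid_scale..].
rewrite -CintegralD; [|exact/complex_rapidZ/complex_rapid_scale..].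
congr Cintegral; apply/funext => v.
by rewrite mxE 2!big_ord_recl big_ord0 addr0 mulrDr; congr (_ + _);
  rewrite mulrCA.
Qed.

Lemma vmomentZ a c w : poly_growth a -> vector_rapid w ->
  vmoment a (fun v => c *: w v) = c *: vmoment a w.
Proof.
move=> ta fw; rewrite -mul_scalar_mx -vmomentM//; congr vmoment.
by apply/funext => v; rewrite mul_scalar_mx.
Qed.

Lemma vmoment_weight a b w :
  vmoment a (fun v => (b v)%:C *: w v) = vmoment (fun v => a v * b v) w.
Proof.
apply/matrixP => k j; rewrite !mxE; congr Cintegral; apply/funext => v.
by rewrite mxE mulrA -rmorphM.
Qed.

Lemma vmoment_ae a w w' : poly_growth a -> vector_rapid w -> vector_rapid w' ->
  {ae mu, forall v, w v = w' v} -> vmoment a w = vmoment a w'.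
Proof.
move=> ta fw fw' ww'; apply/matrixP => k j; rewrite !mxE.
apply: Cintegral_ae; [exact: complex_rapid_scale..|].
by apply: ae_imp ww' => v ->.
Qed.

Lemma vmomentBl a b w : poly_growth a -> poly_growth b -> vector_rapid w ->
  vmoment (fun v => a v - b v) w = vmoment a w - vmoment b w.
Proof.
move=> ta tb fw; apply/matrixP => k j; rewrite !mxE.
rewrite -mulN1r -CintegralZ; last exact: complex_rapid_scale.
rewrite -CintegralD; last 2 first.
- exact: complex_rapid_scale.
- exact/complex_rapidZ/complex_rapid_scale.
by congr Cintegral; apply/funext => v; rewrite rmorphB mulrBl mulN1r.
Qed.

Lemma vmoment_const a (g : R -> R) (x : 'cV[R[i]]_2) : poly_growth a ->
  real_rapid g ->
  vmoment a (fun v => (g v)%:C *: x) = (\int[mu]_v (a v * g v))%:C *: x.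
Proof.
move=> ta fg; apply/matrixP => k j; rewrite !mxE (ord1 j) mulrC.
rewrite -Cintegral_real -CintegralZ; last exact/complex_rapid_real/real_rapidM.
by congr Cintegral; apply/funext => v; rewrite mxE mulrA -rmorphM mulrC.
Qed.

Definition lincomb3 (r0 r1 r2 : R) (x0 x1 x2 : 'cV[R[i]]_2) : 'cV[R[i]]_2 :=
  r0%:C *: x0 + r1%:C *: x1 + r2%:C *: x2.

Lemma eq_lincomb3 (r0 r1 r2 s0 s1 s2 : R) (x0 x1 x2 : 'cV[R[i]]_2) :
  r0 = s0 -> r1 = s1 -> r2 = s2 ->
  lincomb3 r0 r1 r2 x0 x1 x2 = lincomb3 s0 s1 s2 x0 x1 x2.
Proof. by move=> -> -> ->. Qed.

(** The null space of the collision operator. *)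
Definition maxwellian (x0 x1 x2 : 'cV[R[i]]_2) v : 'cV[R[i]]_2 :=
  lincomb3 (omega v) (v * omega v) (v ^+ 2 * omega v) x0 x1 x2.

Lemma vector_rapid_const (g : R -> R) (x : 'cV[R[i]]_2) : real_rapid g ->
  vector_rapid (fun v => (g v)%:C *: x).
Proof.
move=> fg k; under eq_fun do rewrite mxE mulrC.
exact/complex_rapidZ/complex_rapid_real.
Qed.

Lemma real_rapid_omegaX n : real_rapid (fun v : R => v ^+ n * omega v).
Proof. exact/real_rapidM/real_rapid_omega/poly_growth_pow. Qed.

Lemma real_rapid_omega1 : real_rapid (fun v : R => v * omega v).
Proof. exact/real_rapidM/real_rapid_omega/poly_growth_id. Qed.

Lemma vector_rapid_maxwellian x0 x1 x2 : vector_rapid (maxwellian x0 x1 x2).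
Proof.
by apply: vector_rapidD; [apply: vector_rapidD|]; apply: vector_rapid_const;
  [exact: real_rapid_omega|exact: real_rapid_omega1|exact: real_rapid_omegaX].
Qed.

Lemma vmoment_maxwellian a x0 x1 x2 : poly_growth a ->
  vmoment a (maxwellian x0 x1 x2) =
  lincomb3 (\int[mu]_v (a v * omega v)) (\int[mu]_v (a v * (v * omega v)))
    (\int[mu]_v (a v * (v ^+ 2 * omega v))) x0 x1 x2.
Proof.
move=> ta; have f0 : real_rapid (@omega R) := @real_rapid_omega R.
have [f1 f2] := (real_rapid_omega1, real_rapid_omegaX 2).
rewrite vmomentD//; last 2 first.
- by apply: vector_rapidD; exact: vector_rapid_const.
- exact: vector_rapid_const.
by rewrite vmomentD// ?vmoment_const//; exact: vector_rapid_const.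
Qed.

End ComplexMoments.

(** * The averaged transport operator *)

Section Columns.
Set Implicit Arguments.
Unset Strict Implicit.
Unset Printing Implicit Defensive.
Variable F : fieldType.
Implicit Types (a b c d : F) (x y : 'cV[F]_2).

(** Convertible to [mx22] over the complex numbers; the linear algebra is done
    over an abstract field. *)
Definition matrix22 a b c d : 'M[F]_2 :=
  \matrix_(j < 2, k < 2) nth 0 (nth [::] [:: [:: a; b]; [:: c; d]] j) k.

Definition top x : F := x ord0 ord0.
Definition bot x : F := x ord_max ord0.

Lemma col2P x y : top x = top y -> bot x = bot y -> x = y.
Proof.
move=> xt xb; apply/matrixP => k i; rewrite (ord1 i).
case: k => [[|[|//]] k].
  by rewrite (_ : Ordinal k = ord0)//; apply/val_inj.
by rewrite (_ : Ordinal k = ord_max)//; apply/val_inj.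
Qed.

Lemma top0 : top 0 = 0. Proof. by rewrite /top mxE. Qed.
Lemma bot0 : bot 0 = 0. Proof. by rewrite /bot mxE. Qed.
Lemma topD x y : top (x + y) = top x + top y. Proof. by rewrite /top mxE. Qed.
Lemma botD x y : bot (x + y) = bot x + bot y. Proof. by rewrite /bot mxE. Qed.
Lemma topN x : top (- x) = - top x. Proof. by rewrite /top mxE. Qed.
Lemma botN x : bot (- x) = - bot x. Proof. by rewrite /bot mxE. Qed.
Lemma topZ c x : top (c *: x) = c * top x. Proof. by rewrite /top mxE. Qed.
Lemma botZ c x : bot (c *: x) = c * bot x. Proof. by rewrite /bot mxE. Qed.

Lemma top_mul a b c d x : top (matrix22 a b c d *m x) = a * top x + b * bot x.
Proof.
rewrite /top /bot mxE !big_ord_recl big_ord0 addr0 !mxE /=.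
by congr (_ + _ * x _ _); apply/val_inj.
Qed.

Lemma bot_mul a b c d x : bot (matrix22 a b c d *m x) = c * top x + d * bot x.
Proof.
rewrite /top /bot mxE !big_ord_recl big_ord0 addr0 !mxE /=.
by congr (_ + _ * x _ _); apply/val_inj.
Qed.

Definition col2E :=
  (topD, botD, topN, botN, topZ, botZ, top_mul, bot_mul).

(** The transport matrices for v > 0, and for v < 0 below, divided by |v|, with
    f = 1 / e; d is e for [transport0_mx] and 0 for [transport1_mx]. *)
Definition right_mx (f lambda : F) : 'M[F]_2 :=
  matrix22 (lambda * (1 - f)) 0 (- lambda * f) lambda.

Definition left_mx (e d lambda : F) : 'M[F]_2 :=
  matrix22 lambda (- d) 0 (lambda * (1 - e)).

End Columns.

Section Pencil.
Set Implicit Arguments.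
Unset Strict Implicit.
Unset Printing Implicit Defensive.
Variables (F : numFieldType) (e s : F).
Hypotheses (e0 : e != 0) (e1 : 1 - e != 0) (e2 : 2 - e != 0)
  (e3 : 2 * e - 1 != 0) (s0 : s != 0).
Hypothesis nondeg : 32 * s ^+ 2 * (1 + e) ^+ 2 - 5 * (1 - e) ^+ 2 != 0.
Let f := e^-1.
Let lambda := e / ((2 - e) * (2 * e - 1)).
Let kappa := (e * (2 - e))^-1.

Lemma zero_combination (a b u v x : F) : u = 0 -> v = 0 ->
  x = a * u + b * v -> x = 0.
Proof. by move=> -> -> ->; rewrite !mulr0 addr0. Qed.

(** Here a = A p, b = B p, a' = A q and b' = B q in one row of the Gram matrices
    A and B. In terms of the deviation d = q - kappa p from the expected mode,
    eliminating between the two equations gives (A + e B) d = 0, and (A - B) p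
    is a multiple of B d. *)
Lemma pencil_row (a b a' b' : F) :
  lambda * (1 - f) * a + (lambda * b - e * b') = 0 ->
  - lambda * f * a + lambda * a' + lambda * (1 - e) * b' = 0 ->
  (a' - kappa * a) + e * (b' - kappa * b) = 0 /\
  lambda * (1 - f) * (a - b) = e * (b' - kappa * b).
Proof.
move=> h1 h2; split.
  apply: (zero_combination (a := - (2 - f)) (b := lambda^-1) h1 h2).
  rewrite /lambda /f /kappa; field.
  by rewrite e0 e3 e2.
apply/eqP; rewrite -subr_eq0; apply/eqP; rewrite -h1.
by rewrite /lambda /f /kappa; field; rewrite e0 e3 e2.
Qed.

(* the half-line moments, with s = omega 0 *)
Variable h : nat -> F.
Hypotheses (h1 : h 1 = s) (h2 : h 2 = 1 / 2) (h3 : h 3 = 2 * s)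
  (h4 : h 4 = 3 / 2) (h5 : h 5 = 8 * s).

(* One row of the Gram matrices A and B; B is A conjugated by v -> - v. *)
Let right (j : nat) (x0 x1 x2 : F) :=
  h j.+1 * x0 + h j.+2 * x1 + h j.+3 * x2.

Let left (j : nat) (x0 x1 x2 : F) :=
  (-1) ^+ j * h j.+1 * x0 + (-1) ^+ j.+1 * h j.+2 * x1
  + (-1) ^+ j * h j.+3 * x2.

(** Split A = E + O and B = E - O into even and odd parts, so that
    (1 + e) E d + (1 - e) O d = 0 by [pencil_row]. If e <> -1, elimination
    leaves d2 times the quantity in [nondeg]. If e = -1, then O d = 0, so d is a
    multiple of z = v^2 - 3; since z is orthogonal to the range of O and
    z^T E z = 5 s, the second relation of [pencil_row] forces d = 0. Once d = 0,
    that relation says O p = 0, so p is a multiple of z as well. *)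
Lemma pencil_kernel (p0 p1 p2 q0 q1 q2 : F) :
  (forall j, (j < 3)%N ->
    lambda * (1 - f) * right j p0 p1 p2 +
      (lambda * left j p0 p1 p2 - e * left j q0 q1 q2) = 0 /\
    - lambda * f * right j p0 p1 p2 + lambda * right j q0 q1 q2
      + lambda * (1 - e) * left j q0 q1 q2 = 0) ->
  [/\ p1 = 0, p0 = - 3 * p2, q0 = -3 * q2, q1 = 0 & q2 = kappa * p2].
Proof.
move=> H.
pose d0 := q0 - kappa * p0; pose d1 := q1 - kappa * p1;
  pose d2 := q2 - kappa * p2.
have Hr j : (j < 3)%N ->
    right j d0 d1 d2 + e * left j d0 d1 d2 = 0 /\
    lambda * (1 - f) * (right j p0 p1 p2 - left j p0 p1 p2) =
      e * left j d0 d1 d2.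
  move=> j3; have [k1 k2] := H j j3; have [<- ->] := pencil_row k1 k2.
  by rewrite /right /left /d0 /d1 /d2; split; ring.
have [A0 B0] := Hr 0%N isT; have [A1 B1] := Hr 1%N isT.
have [A2 B2] := Hr 2%N isT.
rewrite /right /left h1 h2 h3 ?expr0 ?expr1 in A0 B0.
rewrite /right /left h2 h3 h4 expr1 sqrrN expr1n in A1 B1.
rewrite /right /left h3 h4 h5 sqrrN expr1n exprS sqrrN expr1n in A2 B2.
have lf0 : lambda * (1 - f) != 0.
  have -> : lambda * (1 - f) = - ((1 - e) / ((2 - e) * (2 * e - 1))).
    by rewrite /lambda /f; field; rewrite e0 e2 e3.
  by rewrite oppr_eq0 mulf_neq0// invr_eq0 mulf_neq0.
suff [d0E d1E d2E] : [/\ d0 = 0, d1 = 0 & d2 = 0].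
  rewrite d0E d1E d2E !(mulr0, addr0) in B0 B1.
  have p1E : p1 = 0.
    by apply: (mulfI lf0); rewrite mulr0 -B0; congr (_ * _); field.
  have p0E : p0 = - 3 * p2.
    apply/eqP; rewrite -subr_eq0; apply/eqP; apply: (mulfI lf0).
    by rewrite mulr0 -B1; congr (_ * _); field.
  have dE (x y : F) : x - y = 0 ->
    x = y by move=> /eqP; rewrite subr_eq0 => /eqP.
  move: d0E d1E d2E => /dE -> /dE -> /dE ->.
  by rewrite p1E p0E; split=> //; ring.
have [em1|eN1] := eqVneq (1 + e) 0.
  have eE : e = -1 by apply/eqP; rewrite -subr_eq0 opprK addrC em1.
  have d1E : d1 = 0 by rewrite -A0 eE; field.
  have d0E : d0 = - 3 * d2.
    by apply/eqP; rewrite -subr_eq0; apply/eqP; rewrite -A1 eE d1E; field.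
  have : 5 * s * d2 = 0.
    move/eqP: B0; rewrite -subr_eq0 => /eqP B0.
    move/eqP: B2; rewrite -subr_eq0 => /eqP B2.
    apply: (zero_combination (a := - 3) (b := 1) B0 B2).
    by rewrite eE d0E d1E; field.
  move=> /eqP; rewrite mulf_eq0 mulf_eq0 pnatr_eq0 (negPf s0)/= => /eqP d2E.
  by rewrite d0E d2E mulr0.
have d0E : d0 = 2 * d2.
  apply/eqP; rewrite -subr_eq0; apply/eqP; apply: (mulfI eN1);
    apply: (mulfI s0).
  by rewrite !mulr0; apply: (zero_combination (a := 3) (b := -1) A0 A2); field.
have d2E : d2 = 0.
  apply: (mulfI nondeg); rewrite mulr0.
  apply: (zero_combination (a := 8 * s * (1 + e)) (b := - 2 * (1 - e)) A0 A1).
  by rewrite d0E; field.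
have d1E : d1 = 0.
  apply: (mulfI s0); apply: (mulfI eN1); rewrite !mulr0.
  by apply: (zero_combination (a := 1 / 2) (b := 0) A1 A1); rewrite d0E d2E;
    field.
by rewrite d0E d2E mulr0.
Qed.

(** [pencil_kernel] for the two components at once. *)
Lemma leading_mode (x0 x1 x2 : 'cV[F]_2) :
  (forall j, (j < 3)%N ->
    right_mx f lambda *m (h j.+1 *: x0 + h j.+2 *: x1 + h j.+3 *: x2) +
    left_mx e e lambda *m (((-1) ^+ j * h j.+1) *: x0
      + ((-1) ^+ j.+1 * h j.+2) *: x1 + ((-1) ^+ j * h j.+3) *: x2) = 0) ->
  [/\ x1 = 0, x0 = - 3 *: x2 & bot x2 = kappa * top x2].
Proof.
move=> H.
have [] := @pencil_kernel
  (top x0) (top x1) (top x2) (bot x0) (bot x1) (bot x2).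
  move=> j j3; move: (congr1 (@top _) (H j j3)) (congr1 (@bot _) (H j j3)).
  rewrite !col2E top0 bot0 /right /left => r0 r1.
  by split; [rewrite -[RHS]r0|rewrite -[RHS]r1]; ring.
move=> a1 a0 b0 b1 b2; split; last exact: b2.
  by apply: col2P; rewrite ?top0 ?bot0.
by apply: col2P; rewrite ?topZ ?botZ.
Qed.

(** Y is the unknown Maxwellian part of the corrector. The row (1, 2 e - 1)
    annihilates the sum of the two matrices at lambda, so this combination of
    the two components of the equation no longer contains Y. *)
Lemma eigenvalue_correction (dx l1 cosine c d : F) (x Y : 'cV[F]_2)
    (V := s *: (2 *: x - -3 *: x)) :
  dx != 0 -> top x != 0 -> bot x = kappa * top x -> 2 * cosine = e + f ->
  c = - dx^-1 -> d = - l1 ->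
  right_mx f lambda *m (Y + c *: (right_mx f lambda *m (3 *: x)) + d *: V) +
  left_mx e e lambda *m (Y + c *: (left_mx e e lambda *m (3 *: x)) + d *: V) +
  lambda *: (right_mx f l1 *m V + left_mx e 0 l1 *m V) = 0 ->
  l1 = - (36 / s * (1 - cosine) * lambda ^+ 2 / (5 * dx)).
Proof.
move=> dx0 p0 xE cosE -> -> E.
have {}cosE : cosine = (e + e^-1) / 2 by rewrite -/f -cosE; field.
have key : l1 * (5 * s * dx) = - 36 * (1 - cosine) * lambda ^+ 2.
  apply/eqP; rewrite -subr_eq0; apply/eqP.
  have := congr1 (@bot _) E; rewrite /V !col2E bot0.
  have := congr1 (@top _) E; rewrite /V !col2E top0.
  move=> E0 E1.
  (* k normalizes the coefficient of l1 in the combination to 5 s dx *)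
  pose k := dx / (lambda * (2 - f) * top x).
  apply: (zero_combination (a := k) (b := k * (2 * e - 1)) E0 E1).
  rewrite /k xE cosE /lambda /f /kappa; field.
  by rewrite e0 e2 e3 p0 dx0.
have -> : l1 = l1 * (5 * s * dx) / (5 * s * dx) by field; rewrite dx0 s0.
by rewrite key; field; rewrite dx0 s0.
Qed.
End Pencil.

(** * Collisions and upwind transport *)

Section Transport.
Set Implicit Arguments.
Unset Strict Implicit.
Unset Printing Implicit Defensive.
Context {R : realType}.
Local Notation mu := (@lebesgue_measure R).
Implicit Types (a b : R -> R) (c : R[i]) (v : R) (j k m : nat).
Implicit Types (w : R -> 'cV[R[i]]_2) (P Q : 'M[R[i]]_2) (x : 'cV[R[i]]_2).

Lemma powers_integrals : [/\ \int[mu]_v (v ^+ 0 * omega v) = 1,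
  \int[mu]_v (v ^+ 1 * omega v) = 0, \int[mu]_v (v ^+ 2 * omega v) = 1,
  \int[mu]_v (v ^+ 3 * omega v) = 0 & \int[mu]_v (v ^+ 4 * omega v) = 3].
Proof.
rewrite !powers_integral; have [h1 h2 h3 h4 _] := @half_momentE R.
rewrite h1 h2 h3 h4; split; [|by field..].
by under eq_Rintegral do rewrite expr0 mul1r; exact: omega_integral.
Qed.

Lemma vmoment_maxwellianX j x0 x1 x2 :
  let I k := \int[mu]_v (v ^+ k * omega v) in
  vmoment (fun v => v ^+ j) (maxwellian x0 x1 x2) =
  lincomb3 (I j) (I j.+1) (I j.+2) x0 x1 x2.
Proof.
move=> I; rewrite vmoment_maxwellian; last exact: poly_growth_pow.
apply: eq_lincomb3; [by []|apply: eq_Rintegral => v _..].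
  by rewrite exprSr mulrA.
by rewrite mulrA -exprD addn2.
Qed.

(** The functions 1, v, (v^2 - 1) / 2 are dual to 1, v, v^2 - 1 for the weight
    [omega], so relaxation is towards the Maxwellian with the same mass,
    momentum and energy. *)
Lemma BGK2_maxwellian w : exists x0 x1 x2,
  (forall v, BGK2 w v = maxwellian x0 x1 x2 v - w v) /\
  (vector_rapid w -> forall j, (j < 3)%N ->
    vmoment (fun v => v ^+ j) (maxwellian x0 x1 x2) =
    vmoment (fun v => v ^+ j) w).
Proof.
pose m j := vmoment (fun v => v ^+ j) w.
pose m2 := vmoment (fun v => v ^+ 2 - v ^+ 0) w.
pose x2 := 2^-1 *: m2.
exists (m 0%N - x2), (m 1%N), x2; split.
  move=> v; apply/matrixP => k i; rewrite (ord1 i) !mxE /BGK /Mop.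
  congr (_ - _).
  pose C a := Cintegral (fun u => (a u)%:C * w u k ord0).
  have momE (l : 'I_3) : moments (fun u => w u k ord0) ord0 l =
      C (fun u => nth 0 [:: 1; u; u ^+ 2 - 1] l).
    by rewrite mxE; congr Cintegral; apply/funext => u; rewrite mxE.
  rewrite mxE !big_ord_recl big_ord0 !momE ![Psi _ _ _]mxE /= -!/(C _) addr0.
  under [fun u => u ^+ 2 - u ^+ 0]eq_fun do rewrite expr0.
  under [fun u => u ^+ 0]eq_fun do rewrite expr0.
  under [fun u => u ^+ 1]eq_fun do rewrite expr1.
  move: (C _) (C _) (C _) (omega v) => m0 m1 m2' o.
  rewrite !rmorphM !rmorphB !rmorphXn /= rmorph1 fmorphV rmorph_nat.
  by field.
move=> fw j; have t n : poly_growth (fun v : R => v ^+ n)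
  by exact: poly_growth_pow.
have m2E : m2 = m 2%N - m 0%N by rewrite /m2 vmomentBl.
have x2E : x2 + x2 = m2.
  by rewrite /x2 -scalerDl -[RHS]scale1r; congr (_ *: _); field.
have [i0 i1 i2 i3 i4] := powers_integrals.
case: j => [|[|[|//]]] _;
  rewrite vmoment_maxwellianX /lincomb3 ?(i0, i1, i2, i3, i4);
  rewrite ?(rmorph0, rmorph1, scale1r, scale0r, addr0, add0r) ?subrK//.
rewrite -[_%:C](_ : 1 + 2 = _); last by rewrite -[3]/(1 + 2) rmorphD rmorph_nat.
rewrite scalerDl scale1r addrA subrK scaler_nat mulr2n x2E m2E addrC subrK //.
Qed.

Lemma vmoment_BGK2 w j : vector_rapid w -> (j < 3)%N ->
  vmoment (fun v => v ^+ j) (BGK2 w) = 0.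
Proof.
move=> fw j3; have [x0 [x1 [x2 [wE mE]]]] := BGK2_maxwellian w.
have t : poly_growth (fun v : R => v ^+ j) by exact: poly_growth_pow.
rewrite (_ : BGK2 w = fun v => maxwellian x0 x1 x2 v + (-1) *: w v); last first.
  by apply/funext => v; rewrite wE scaleN1r.
rewrite vmomentD//; [|exact: vector_rapid_maxwellian|exact: vector_rapidZ].
by rewrite vmomentZ// mE// scaleN1r subrr.
Qed.

Lemma vector_rapid_BGK2 w : vector_rapid w -> vector_rapid (BGK2 w).
Proof.
move=> fw; have [x0 [x1 [x2 [wE _]]]] := BGK2_maxwellian w.
rewrite (_ : BGK2 w = fun v => maxwellian x0 x1 x2 v + (-1) *: w v); last first.
  by apply/funext => v; rewrite wE scaleN1r.
by apply: vector_rapidD; [exact: vector_rapid_maxwellian|exact: vector_rapidZ].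
Qed.

Lemma right_maxwellian j m x0 x1 x2 :
  vmoment (fun v => v ^+ j * posp v ^+ m.+1) (maxwellian x0 x1 x2) =
  lincomb3 (half_moment (j + m).+1) (half_moment (j + m).+2)
    (half_moment (j + m).+3) x0 x1 x2.
Proof.
have E k v : v ^+ j * posp v ^+ m.+1 * v ^+ k = posp v ^+ (j + m + k).+1.
  by rewrite mulrAC -exprD exprS mulrA powers_posp -exprD addSn addnAC.
rewrite vmoment_maxwellian; last first.
  by apply: poly_growthM; apply: poly_growth_exp; [exact: poly_growth_id|
    exact: poly_growth_posp].
rewrite -!pospX_integral.
apply: eq_lincomb3; apply: eq_Rintegral => v _.
- by have := E 0%N v; rewrite expr0 mulr1 addn0 => ->.
- by rewrite mulrA (E 1%N) addn1.
- by rewrite mulrA E addn2.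
Qed.

Lemma left_maxwellian j m x0 x1 x2 :
  vmoment (fun v => v ^+ j * leftp v ^+ m.+1) (maxwellian x0 x1 x2) =
  lincomb3 ((-1) ^+ j * half_moment (j + m).+1)
    ((-1) ^+ j.+1 * half_moment (j + m).+2)
    ((-1) ^+ j * half_moment (j + m).+3) x0 x1 x2.
Proof.
have E k v : v ^+ j * leftp v ^+ m.+1 * v ^+ k =
    (-1) ^+ (j + k) * leftp v ^+ (j + m + k).+1.
  by rewrite mulrAC -exprD exprS mulrA powers_leftp -mulrA -exprD addSn addnAC.
rewrite vmoment_maxwellian; last first.
  by apply: poly_growthM; apply: poly_growth_exp;
    [exact: poly_growth_id|exact: poly_growth_leftp].
have i n : mu.-integrable setT (EFin \o (fun v => leftp v ^+ n * omega v)).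
  exact/integrable_growthM/poly_growth_exp/poly_growth_leftp.
rewrite -!leftpX_integral -!RintegralZl//.
apply: eq_lincomb3; apply: eq_Rintegral => v _.
- by have := E 0%N v; rewrite expr0 mulr1 !addn0 mulrA => ->.
- by rewrite mulrA (E 1%N) !addn1 mulrA.
- by rewrite mulrA E !addn2 mulrA !exprS; congr (_ * _ * _);
  rewrite mulrA mulrNN !mul1r.
Qed.

Definition upwind P Q v : 'M[R[i]]_2 := (posp v)%:C *: P + (leftp v)%:C *: Q.

Lemma upwindE P Q w v : upwind P Q v *m w v =
  P *m ((posp v)%:C *: w v) + Q *m ((leftp v)%:C *: w v).
Proof. by rewrite /upwind mulmxDl -!scalemxAl -!scalemxAr. Qed.

Lemma vector_rapid_upwind P Q w : vector_rapid w ->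
  vector_rapid (fun v => upwind P Q v *m w v).
Proof.
move=> fw; under eq_fun do rewrite upwindE.
apply: vector_rapidD; apply: vector_rapidM; apply: vector_rapid_scale => //.
  exact: poly_growth_posp.
exact: poly_growth_leftp.
Qed.

Lemma vmoment_upwind a P Q w : poly_growth a -> vector_rapid w ->
  vmoment a (fun v => upwind P Q v *m w v) =
  P *m vmoment (fun v => a v * posp v) w + Q *m vmoment (fun v => a v * leftp
    v) w.
Proof.
move=> ta fw; under [fun v => upwind P Q v *m _]eq_fun do rewrite upwindE.
have tp := @poly_growth_posp R; have tl := @poly_growth_leftp R.
rewrite vmomentD//; [|exact/vector_rapidM/vector_rapid_scale..].
by rewrite !vmomentM ?vmoment_weight//; exact: vector_rapid_scale.
Qed.

Lemma vmoment0 w : vector_rapid w -> vmoment (fun=> 0) w = 0.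
Proof.
move=> fw; apply/matrixP => k i; rewrite !mxE.
by rewrite (CintegralZ 0 (fw k)) mul0r.
Qed.

(** Since v^+ v^- = 0, only the matrix P acts on the right half-line. *)
Lemma right_upwind j P Q w : vector_rapid w ->
  vmoment (fun v => v ^+ j * posp v) (fun v => upwind P Q v *m w v) =
  P *m vmoment (fun v => v ^+ j * posp v ^+ 2) w.
Proof.
move=> fw; have tp := @poly_growth_posp R; have tj := @poly_growth_pow R j.
rewrite vmoment_upwind//; last exact: poly_growthM.
rewrite [X in _ + Q *m X](_ : _ = 0) ?mulmx0 ?addr0.
  by under [fun v => _ * _ * _]eq_fun do rewrite -mulrA -expr2.
under [fun v => _ * _ * _]eq_fun do rewrite -mulrA posp_leftp mulr0.
exact: vmoment0.
Qed.

Lemma left_upwind j P Q w : vector_rapid w ->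
  vmoment (fun v => v ^+ j * leftp v) (fun v => upwind P Q v *m w v) =
  Q *m vmoment (fun v => v ^+ j * leftp v ^+ 2) w.
Proof.
move=> fw; have tp := @poly_growth_leftp R; have tj := @poly_growth_pow R j.
rewrite vmoment_upwind//; last exact: poly_growthM.
rewrite [X in P *m X + _](_ : _ = 0) ?mulmx0 ?add0r.
  by under [fun v => _ * _ * _]eq_fun do rewrite -mulrA -expr2.
under [fun v => _ * _ * _]eq_fun do rewrite -mulrA [leftp _ * _]mulrC
  posp_leftp mulr0.
exact: vmoment0.
Qed.

Lemma negpE v : negp v = - leftp v. Proof. by rewrite /leftp opprK. Qed.

Lemma transport0_upwind eta lambda v : transport0_mx eta lambda v =
  upwind (right_mx (cis (- eta)) lambda) (left_mx (cis eta) (cis eta) lambda) v.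
Proof.
have nE : `|v|%:C = (posp v)%:C + (leftp v)%:C by rewrite normr_posp rmorphD.
have gE : (negp v)%:C = - (leftp v)%:C by rewrite negpE rmorphN.
rewrite /transport0_mx /upwind nE ?gE.
move: (posp v)%:C (leftp v)%:C (cis eta) (cis (- eta)) => p l e f.
by apply/matrixP => [[[|[|//]] i] [[|[|//]] k]]; rewrite !mxE /=; ring.
Qed.

Lemma transport1_upwind eta lambda v : transport1_mx eta lambda v =
  upwind (right_mx (cis (- eta)) lambda) (left_mx (cis eta) 0 lambda) v.
Proof.
have nE : `|v|%:C = (posp v)%:C + (leftp v)%:C by rewrite normr_posp rmorphD.
have gE : (negp v)%:C = - (leftp v)%:C by rewrite negpE rmorphN.
rewrite /transport1_mx /upwind nE ?gE.
move: (posp v)%:C (leftp v)%:C (cis eta) (cis (- eta)) => p l e f.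
by apply/matrixP => [[[|[|//]] i] [[|[|//]] k]]; rewrite !mxE /=; ring.
Qed.

End Transport.

(** * The phase exp(i eta) *)

Section Phase.
Set Implicit Arguments.
Unset Strict Implicit.
Unset Printing Implicit Defensive.
Context {R : realType}.
Implicit Types eta : R.

Lemma cis_neq0 eta : cis eta != 0.
Proof.
apply/eqP => -[c0 s0]; have := cos2Dsin2 eta.
by rewrite c0 s0 expr0n addr0 => /eqP; rewrite eq_sym oner_eq0.
Qed.

Lemma cisN eta : cis (- eta) = (cis eta)^-1.
Proof.
apply: (mulfI (cis_neq0 eta)); rewrite mulfV ?cis_neq0//.
apply/eqP; rewrite eq_complex /= cosN sinN; apply/andP; split; apply/eqP.
  by rewrite mulrN opprK -!expr2 cos2Dsin2.
by ring.
Qed.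

Lemma cisDcisV eta : 2 * (cos eta)%:C = cis eta + (cis eta)^-1.
Proof.
rewrite -cisN; apply/eqP; rewrite eq_complex /= cosN sinN.
by apply/andP; split; apply/eqP; ring.
Qed.

Lemma cos_lt1 eta : 0 < eta -> eta < 2 * pi -> cos eta < 1.
Proof.
move=> e0 e2pi; have -> : eta = (eta / 2) *+ 2 by rewrite -mulr_natr; field.
have sp : 0 < sin (eta / 2) by apply: sin_gt0_pi; lra.
by rewrite cos_mulr2n -mulr_natr; have := cos2Dsin2 (eta / 2); nra.
Qed.

Lemma denom_phase eta :
  (5 - 4 * cos eta)%:C * cis eta = (2 - cis eta) * (2 * cis eta - 1).
Proof.
have e0 := cis_neq0 eta.
rewrite rmorphB rmorphM !rmorph_nat (_ : 4 = 2 * 2); last by rewrite -natrM.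
by rewrite -mulrA cisDcisV; field.
Qed.

Lemma denom_gt0 eta : 0 < 5 - 4 * cos eta.
Proof. by have := cos_le1 eta; lra. Qed.

(** Divided by e, the expression is real, and a sum of a nonnegative and a
    positive term. *)
Lemma nondeg_phase eta (s : R) : cos eta < 1 ->
  32 * s%:C ^+ 2 * (1 + cis eta) ^+ 2 - 5 * (1 - cis eta) ^+ 2 != 0.
Proof.
move=> c1; have e0 := cis_neq0 eta; set e := cis eta.
have -> : 32 * s%:C ^+ 2 * (1 + e) ^+ 2 - 5 * (1 - e) ^+ 2 =
    e * (64 * s ^+ 2 * (1 + cos eta) + 10 * (1 - cos eta))%:C.
  have cE : 2 * (cos eta)%:C = e + e^-1 := cisDcisV eta.
  have -> : (1 + e) ^+ 2 = e * (2 + 2 * (cos eta)%:C) by rewrite cE; field.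
  have -> : (1 - e) ^+ 2 = e * (2 * (cos eta)%:C - 2) by rewrite cE; field.
  by ring.
rewrite mulf_neq0// eq_complex /= eqxx andbT gt_eqF//.
rewrite ltr_wpDl//; last by rewrite mulr_gt0// subr_gt0.
apply: mulr_ge0; first by rewrite mulr_ge0// sqr_ge0.
by have := cos_geN1 eta; lra.
Qed.

End Phase.

(** * Solvability of the successive orders *)

Section Assembly.
Set Implicit Arguments.
Unset Strict Implicit.
Unset Printing Implicit Defensive.
Context {R : realType}.
Local Notation mu := (@lebesgue_measure R).
Implicit Types (w : R -> 'cV[R[i]]_2) (v : R).

Lemma half_momentC (s := (omega (0 : R))%:C) :
  [/\ (@half_moment R 1)%:C = s, (@half_moment R 2)%:C = 1 / 2,
      (@half_moment R 3)%:C = 2 * s, (@half_moment R 4)%:C = 3 / 2 &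
      (@half_moment R 5)%:C = 8 * s /\ (@half_moment R 6)%:C = 15 / 2].
Proof.
have [-> -> -> -> [-> ->]] := @half_momentE R.
by split; try split; rewrite /s; field.
Qed.

(** Moments against z b with z = v^2 - 3. As z spans the kernel of the odd part
    of the Gram matrices, a Maxwellian has the same moment for both half-line
    weights b. *)
Definition zmoment (b : R -> R) w : 'cV[R[i]]_2 :=
  vmoment (fun v => v ^+ 2 * b v) w - 3 *: vmoment (fun v => v ^+ 0 * b v) w.

Lemma ae_imp2 (A B C : R -> Prop) : (forall v, A v -> B v -> C v) ->
  {ae mu, forall v, A v} -> {ae mu, forall v, B v} -> {ae mu, forall v, C v}.
Proof. by move=> ABC; apply: (@filterS2 _ (almost_everywhere mu)). Qed.

(** Collisions conserve the moments of 1, v and v^2. *)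
Lemma vmoment_collision (dx : R[i]) w f j : (j < 3)%N -> vector_rapid f ->
  vector_rapid w ->
  {ae mu, forall v, f v = dx *: BGK2 w v} ->
  vmoment (fun v => v ^+ j) f = 0.
Proof.
move=> j3 ff fw fE; have t : poly_growth (fun v : R => v ^+ j).
  exact: poly_growth_pow.
have fB := vector_rapid_BGK2 fw.
rewrite (vmoment_ae t ff _ fE); last exact: vector_rapidZ.
by rewrite vmomentZ// vmoment_BGK2// scaler0.
Qed.

Lemma leading_maxwellian (e lambda : R[i]) x0 x1 x2 :
  e != 0 -> 1 - e != 0 -> 2 - e != 0 -> 2 * e - 1 != 0 ->
  lambda = e / ((2 - e) * (2 * e - 1)) ->
  32 * (omega (0 : R))%:C ^+ 2 * (1 + e) ^+ 2 - 5 * (1 - e) ^+ 2 != 0 ->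
  (forall j, (j < 3)%N ->
    vmoment (fun v => v ^+ j) (fun v =>
      upwind (right_mx e^-1 lambda) (left_mx e e lambda) v *m
      maxwellian x0 x1 x2 v) = 0) ->
  [/\ x1 = 0, x0 = - 3 *: x2 & bot x2 = (e * (2 - e))^-1 * top x2].
Proof.
move=> e0 e1 e2 e3 -> nd H.
have s0 : (omega (0 : R))%:C != 0.
  by rewrite eq_complex /= eqxx andbT gt_eqF ?omega_gt0.
have [h1 h2 h3 h4 [h5 _]] := half_momentC.
apply: (leading_mode e0 e1 e2 e3 s0 nd (h :=
  fun n => (half_moment n)%:C) h1 h2 h3 h4 h5).
move=> j j3; rewrite -[RHS](H j j3) vmoment_upwind; last 2 first.
- exact: poly_growth_pow.
- exact: vector_rapid_maxwellian.
rewrite (right_maxwellian _ 0) (left_maxwellian _ 0) addn0.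
have signM i (r : R) : (-1) ^+ i * r%:C = ((-1) ^+ i * r)%:C.
  by rewrite rmorphM rmorphXn rmorphN1.
by rewrite /lincomb3 !signM.
Qed.

Lemma poly_growth_powerM j (b : R -> R) : poly_growth b ->
  poly_growth (fun v => v ^+ j * b v).
Proof. by move=> tb; apply: poly_growthM => //; exact: poly_growth_pow. Qed.

Lemma zmomentD b w w' : poly_growth b -> vector_rapid w -> vector_rapid w' ->
  zmoment b (fun v => w v + w' v) = zmoment b w + zmoment b w'.
Proof.
move=> tb fw fw'; rewrite /zmoment !vmomentD//; [|exact: poly_growth_powerM..].
by rewrite scalerDr opprD addrACA.
Qed.

Lemma zmomentZ b c w : poly_growth b -> vector_rapid w ->
  zmoment b (fun v => c *: w v) = c *: zmoment b w.
Proof.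
move=> tb fw; rewrite /zmoment !vmomentZ//; [|exact: poly_growth_powerM..].
by rewrite scalerBr !scalerA mulrC.
Qed.

Lemma zmoment_ae b w w' : poly_growth b -> vector_rapid w -> vector_rapid w' ->
  {ae mu, forall v, w v = w' v} -> zmoment b w = zmoment b w'.
Proof.
move=> tb fw fw' E; rewrite /zmoment.
by congr (_ - _ *: _); apply: vmoment_ae => //; exact: poly_growth_powerM.
Qed.

Lemma zmoment_corrector b lambda w w' m t W c d : poly_growth b ->
  vector_rapid w -> vector_rapid w' -> vector_rapid m -> vector_rapid t ->
    vector_rapid W ->
  {ae mu, forall v, lambda *: w v = m v + c *: t v + d *: W v} ->
  {ae mu, forall v, w' v = W v} ->
  lambda *: zmoment b w = zmoment b m + c *: zmoment b t + d *: zmoment b W /\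
  zmoment b w' = zmoment b W.
Proof.
move=> tb fw fw' fm ft fW wE wE'; split; last exact: zmoment_ae.
have fct := vector_rapidZ c ft; have fdW := vector_rapidZ d fW.
have fmt := vector_rapidD fm fct.
rewrite -(zmomentZ lambda tb fw) (zmoment_ae tb (vector_rapidZ lambda fw)
  (vector_rapidD fmt fdW) wE).
by rewrite (zmomentD tb fmt fdW) (zmomentD tb fm fct) (zmomentZ c tb ft)
  (zmomentZ d tb fW).
Qed.

(** The first-order relation, which expresses lambda w through a Maxwellian m,
    the transport term t and the leading mode W, is inserted into the
    second-order moment equation. *)
Lemma averaged_corrector (P Q P1 Q1 : 'M[R[i]]_2) (X Y V : 'cV[R[i]]_2)
    lambda w w' m t W c d :
  vector_rapid w -> vector_rapid w' -> vector_rapid m -> vector_rapid t ->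
    vector_rapid W ->
  {ae mu, forall v, lambda *: w v = m v + c *: t v + d *: W v} ->
  {ae mu, forall v, w' v = W v} ->
  P *m zmoment (@posp R) w + Q *m zmoment (@leftp R) w +
    (P1 *m zmoment (@posp R) w' + Q1 *m zmoment (@leftp R) w') = 0 ->
  (zmoment (@posp R) m = Y) * (zmoment (@leftp R) m = Y) ->
  (zmoment (@posp R) t = P *m X) * (zmoment (@leftp R) t = Q *m X) ->
  (zmoment (@posp R) W = V) * (zmoment (@leftp R) W = V) ->
  P *m (Y + c *: (P *m X) + d *: V) + Q *m (Y + c *: (Q *m X) + d *: V) +
    lambda *: (P1 *m V + Q1 *m V) = 0.
Proof.
move=> fw fw' fm ft fW wE wE' E [mp ml] [tp tl] [Wp Wl].
have [r1 r2] := zmoment_corrector (@poly_growth_posp R) fw fw' fm ft fW wE wE'.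
have [l1 l2] := zmoment_corrector (@poly_growth_leftp R) fw fw' fm ft fW wE wE'.
rewrite mp tp Wp in r1; rewrite ml tl Wl in l1; rewrite Wp in r2;
  rewrite Wl in l2.
rewrite -r1 -l1 -!scalemxAr -!scalerDr.
by rewrite -r2 -[Q1 *m zmoment _ _](congr1 (mulmx Q1) (etrans l2 (esym r2))) E
  scaler0.
Qed.

Lemma zmoment_maxwellian x0 x1 x2 :
  (zmoment (@posp R) (maxwellian x0 x1 x2) =
    (omega (0 : R))%:C *: (2 *: x2 - x0)) *
  (zmoment (@leftp R) (maxwellian x0 x1 x2) =
    (omega (0 : R))%:C *: (2 *: x2 - x0)).
Proof.
have [h1 h2 h3 h4 [h5 h6]] := half_momentC.
rewrite /zmoment !(right_maxwellian _ 0) !(left_maxwellian _ 0) /lincomb3 /=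
  !addn0.
rewrite !(expr0, expr1, expr2, exprS, mulr1, mulrN, mulNr, opprK, mul1r).
have realN (r : R) : (- r)%:C = - r%:C by exact: rmorphN.
rewrite !realN.
rewrite h1 h2 h3 h4 h5; move: (omega (0 : R))%:C => s.
by split; apply/matrixP => i k; rewrite !mxE; field.
Qed.

Lemma zmoment_upwind_maxwellian P Q x0 x1 x2 : x1 = 0 -> x0 = -3 *: x2 ->
  (zmoment (@posp R) (fun v => upwind P Q v *m maxwellian x0 x1 x2 v) =
    P *m (3 *: x2)) *
  (zmoment (@leftp R) (fun v => upwind P Q v *m maxwellian x0 x1 x2 v) =
    Q *m (3 *: x2)).
Proof.
move=> x1E x0E; have [h1 h2 h3 h4 [h5 h6]] := half_momentC.
have fm := @vector_rapid_maxwellian R x0 x1 x2.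
rewrite /zmoment !right_upwind// !left_upwind// !(right_maxwellian _ 1)
  !(left_maxwellian _ 1).
rewrite /lincomb3 /= x1E !scaler0 !addr0 !(expr0, expr2, mulN1r, opprK, mul1r).
rewrite !scalemxAr -!mulmxBr.
by split; congr (_ *m _); rewrite h2 h4 h6 x0E; apply/matrixP => i k;
  rewrite !mxE; field.
Qed.

Lemma zmoment_conserved P Q w : vector_rapid w ->
  vmoment (fun v => v ^+ 2) (fun v => upwind P Q v *m w v) -
    3 *: vmoment (fun v => v ^+ 0) (fun v => upwind P Q v *m w v) =
  P *m zmoment (@posp R) w + Q *m zmoment (@leftp R) w.
Proof.
move=> fw; have t j : poly_growth (fun v : R => v ^+ j)
  by exact: poly_growth_pow.
rewrite !vmoment_upwind// /zmoment !mulmxBr -!scalemxAr scalerDr opprD.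
by rewrite addrACA.
Qed.

End Assembly.

Theorem theoremA2 (R : realType) (eta dx : R)
  (lambda0 lambda1 lambda2 : R[i]) (w0 w1 w2 : R -> 'cV[R[i]]_2)
  (eta_gt0 : 0 < eta) (eta_lt2pi : eta < 2 * pi) (dx_gt0 : 0 < dx)
  (w0_L2 : weighted_L2_2 w0) (w1_L2 : weighted_L2_2 w1)
  (w2_L2 : weighted_L2_2 w2)
  (order0 : {ae @lebesgue_measure R, forall v : R,
     lambda0 *: BGK2 w0 v = 0})
  (order1 : {ae @lebesgue_measure R, forall v : R,
     transport0_mx eta lambda0 v *m w0 v =
     dx%:C *: BGK2 (fun u => lambda0 *: w1 u + lambda1 *: w0 u) v})
  (order2 : {ae @lebesgue_measure R, forall v : R,
     transport0_mx eta lambda0 v *m w1 v + transport1_mx eta lambda1 v *m w0 v =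
     dx%:C *: BGK2 (fun u => lambda0 *: w2 u + lambda1 *: w1 u
                             + lambda2 *: w0 u) v})
  (w0_neq0 : ~ {ae @lebesgue_measure R, forall v : R, w0 v = 0})
  (lambda0E : lambda0 = (1 / (5 - 4 * cos eta))%:C) :
  lambda1 = (- ((36 * Num.sqrt (2 * pi) * (1 - cos eta)) /
                (5 * dx * (5 - 4 * cos eta) ^+ 2)))%:C /\
  lambda1 < 0.
Proof.
have c1 := cos_lt1 eta_gt0 eta_lt2pi.
have D0 := denom_gt0 eta.
pose e := cis eta.
have e0 : e != 0 by exact: cis_neq0.
have DE : (5 - 4 * cos eta)%:C * e = (2 - e) * (2 * e - 1)
  by exact: denom_phase.
have DC0 : (5 - 4 * cos eta)%:C != 0.
  by rewrite eq_complex /= eqxx andbT gt_eqF.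
have : (2 - e) * (2 * e - 1) != 0 by rewrite -DE mulf_neq0.
rewrite mulf_eq0 negb_or => /andP[e2 e3].
have e1 : 1 - e != 0.
  by rewrite eq_complex /= negb_and subr_eq0 eq_sym lt_eqF.
have nd := nondeg_phase (omega 0) c1.
have lE : lambda0 = e / ((2 - e) * (2 * e - 1)).
  by rewrite -DE lambda0E div1r fmorphV invfM mulrCA mulfV// mulr1.
have l0 : lambda0 != 0 by rewrite lE mulf_neq0// invr_eq0 mulf_neq0.
have dxC0 : dx%:C != 0 by rewrite eq_complex /= eqxx andbT gt_eqF.
pose P := right_mx e^-1 lambda0; pose Q := left_mx e e lambda0.
pose P1 := right_mx e^-1 lambda1; pose Q1 := left_mx e 0 lambda1.
have T0E v : transport0_mx eta lambda0 v = upwind P Q v.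
  by rewrite transport0_upwind cisN.
have T1E v : transport1_mx eta lambda1 v = upwind P1 Q1 v.
  by rewrite transport1_upwind cisN.
have [f0 f1 f2] := And3 (vector_rapid_L2 w0_L2) (vector_rapid_L2 w1_L2)
  (vector_rapid_L2 w2_L2).
have [x0 [x1 [x2 [w0B _]]]] := BGK2_maxwellian w0.
pose W := maxwellian x0 x1 x2.
have fW : vector_rapid W by exact: vector_rapid_maxwellian.
have w0W : {ae @lebesgue_measure R, forall v : R, w0 v = W v}.
  apply: ae_imp order0 => v /eqP; rewrite scaler_eq0 (negPf l0)/= w0B subr_eq0.
  by move=> /eqP.
pose u v := lambda0 *: w1 v + lambda1 *: w0 v.
have fu : vector_rapid u by apply: vector_rapidD; exact: vector_rapidZ.
have TW : {ae @lebesgue_measure R, forall v : R,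
    upwind P Q v *m W v = dx%:C *: BGK2 u v}.
  by apply: ae_imp2 order1 w0W => v; rewrite T0E => h <-.
have fTW := vector_rapid_upwind P Q fW.
have [x1E x0E x2E] : [/\ x1 = 0, x0 = - 3 *: x2 & bot x2 = (e *
  (2 - e))^-1 * top x2].
  apply: (leading_maxwellian e0 e1 e2 e3 lE nd) => j j3.
  exact: vmoment_collision j3 fTW fu TW.
have p0 : top x2 != 0.
  apply/eqP => p0; apply: w0_neq0; apply: ae_imp w0W => v ->.
  have x20 : x2 = 0 by apply: col2P; rewrite ?x2E p0 ?mulr0 ?top0 ?bot0.
  by rewrite /W /maxwellian /lincomb3 x0E x1E x20 !scaler0 !addr0.
(* y0, y1, y2 carry the undetermined Maxwellian part of the corrector *)
have [y0 [y1 [y2 [uB _]]]] := BGK2_maxwellian u.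
pose Y := (omega (0 : R))%:C *: (2 *: y2 - y0).
have w1E : {ae @lebesgue_measure R, forall v : R, lambda0 *: w1 v =
    maxwellian y0 y1 y2 v + (- dx%:C^-1) *: (upwind P Q v *m W v)
    + (- lambda1) *: W v}.
  apply: ae_imp2 TW w0W => v -> w0v.
  rewrite scalerA mulNr mulVf// scaleN1r uB opprB [maxwellian _ _ _ _ + _]addrC.
  by rewrite subrK scaleNr -w0v /u addrK.
have fm := @vector_rapid_maxwellian R y0 y1 y2.
(* the second-order moments of v^2 and 1, combined into that of z *)
have E2 : P *m zmoment (@posp R) w1 + Q *m zmoment (@leftp R) w1 +
    (P1 *m zmoment (@posp R) w0 + Q1 *m zmoment (@leftp R) w0) = 0.
  have fT0 := vector_rapid_upwind P Q f1;
    have fT1 := vector_rapid_upwind P1 Q1 f0.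
  have m j : (j < 3)%N ->
    vmoment (fun v => v ^+ j) (fun v => upwind P Q v *m w1 v) +
      vmoment (fun v => v ^+ j) (fun v => upwind P1 Q1 v *m w0 v) = 0.
    move=> j3; rewrite -vmomentD//; last exact: poly_growth_pow.
    have fv : vector_rapid (fun v => lambda0 *: w2 v + lambda1 *: w1 v +
      lambda2 *: w0 v).
      by apply: vector_rapidD; [apply: vector_rapidD|]; exact: vector_rapidZ.
    apply: (vmoment_collision (dx := dx%:C) j3 (vector_rapidD fT0 fT1) fv).
    by apply: ae_imp order2 => v; rewrite T0E T1E.
  apply: (etrans (congr2 +%R (esym (zmoment_conserved P Q f1))
    (esym (zmoment_conserved P1 Q1 f0)))).
  rewrite addrACA -opprD.
  by rewrite -scalerDr (m 2%N isT) (m 0%N isT) scaler0 subr0.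
have := averaged_corrector f1 f0 fm fTW fW w1E w0W E2 (zmoment_maxwellian _ _ _)
  (zmoment_upwind_maxwellian P Q x1E x0E) (zmoment_maxwellian _ _ _).
rewrite x0E => E.
have s0 : (omega (0 : R))%:C != 0.
  by rewrite eq_complex /= eqxx andbT gt_eqF ?omega_gt0.
have key : lambda1 = - (36 / (omega (0 : R))%:C * (1 - (cos eta)%:C) *
    (e / ((2 - e) * (2 * e - 1))) ^+ 2 / (5 * dx%:C)).
  apply: (eigenvalue_correction e0 e2 e3 s0 dxC0 p0 x2E (cisDcisV eta) erefl
    erefl (Y := Y)).
  by rewrite -lE; exact: E.
have l1E : lambda1 = (- ((36 * Num.sqrt (2 * pi) * (1 - cos eta)) /
                (5 * dx * (5 - 4 * cos eta) ^+ 2)))%:C.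
  have sE : (omega (0 : R))^-1 = Num.sqrt (2 * pi) by rewrite omega_at0 invrK.
  rewrite key -lE lambda0E -sE.
  have D1 : 5 - 4 * cos eta != 0 by rewrite gt_eqF.
  have dx1 : dx != 0 by rewrite gt_eqF.
  have o1 : omega (0 : R) != 0 by rewrite gt_eqF ?omega_gt0.
  move: (5 - 4 * cos eta) D1 (omega 0) o1 => D D1 o o1; move: (cos eta) => c.
  have -> : 36 / o%:C * (1 - c%:C) * (1 / D)%:C ^+ 2 / (5 * dx%:C) =
      (36 / o * (1 - c) * (1 / D) ^+ 2 / (5 * dx))%:C.
    by field; rewrite !fmorph_eq0 dx1 D1 o1.
  rewrite -rmorphN; congr (- _)%:C.
  by field; rewrite D1 o1 dx1.
split=> //; rewrite l1E ltcR oppr_lt0 divr_gt0// !mulr_gt0 ?exprn_gt0//.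
  by rewrite sqrtr_gt0 mulr_gt0// pi_gt0.
by rewrite subr_gt0.
Qed.
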